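(* Let $p>3$ be a prime. Then, modulo $p^2$, \[ \sum_{k=1}^{p-1}H_{k}^3\equiv \frac{1}{3}pB_{p-3}-6p+6,\qquad \sum_{k=1}^{p-1}kH_k^3\equiv \frac{27}{8}p-\frac{1}{6}pB_{p-3}-3, \] \[ \sum_{k=1}^{p-1}k^2H_k^3\equiv-\frac{365}{216}p+\frac{1}{18}pB_{p-3}+\frac{23}{18},\qquad \sum_{k=1}^{p-1}k^3H_k^3\equiv \frac{425}{576}p-\frac{5}{12}. \]
   Context: $H_n=\sum_{i=1}^n 1/i$ are the harmonic numbers. $B_0,B_1,B_2,\dots$ are the Bernoulli numbers defined by $B_0=1$ and $\sum_{k=0}^n\binom{n+1}{k}B_k=0$ for $n\ge1$. For rationals $a,b$ whose denominators are coprime to $p$, $a\equiv b\pmod{p^2}$ means that $a-b$, written in lowest terms, has numerator divisible by $p^2$. *)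

(* Defs.v *)
From mathcomp Require Import all_boot all_order all_algebra.

Set Implicit Arguments.
Unset Strict Implicit.
Unset Printing Implicit Defensive.

Import GRing.Theory.
Local Open Scope ring_scope.

Definition harmonic (n : nat) : rat := \sum_(1 <= i < n.+1) i%:R^-1.

(* [:: B_0; ...; B_n], with B_n obtained from the preceding terms by solving
   \sum_(k <= n) 'C(n + 1, k) B_k = 0 for its last term (n + 1) B_n. *)
Fixpoint bernoulli_seq (n : nat) : seq rat :=
  if n is m.+1 then
    let s := bernoulli_seq m in
    rcons s (- (n.+1%:R^-1 * \sum_(k < n) 'C(n.+1, k)%:R * s`_k))
  else [:: 1].

Definition bernoulli (n : nat) : rat := (bernoulli_seq n)`_n.

Lemma size_bernoulli_seq n : size (bernoulli_seq n) = n.+1.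
Proof. by elim: n => //= n IHn; rewrite size_rcons IHn. Qed.

Lemma nth_bernoulli_seq n k :
  (k <= n)%N -> (bernoulli_seq n)`_k = bernoulli k.
Proof.
elim: n => [|n IHn]; first by rewrite leqn0 => /eqP ->.
rewrite leq_eqVlt => /predU1P[-> //|ltkn].
by rewrite /= nth_rcons size_bernoulli_seq ltkn IHn.
Qed.

Lemma bernoulli0 : bernoulli 0 = 1.
Proof. by []. Qed.

Lemma bernoulli_rec n : (0 < n)%N ->
  \sum_(0 <= k < n.+1) 'C(n.+1, k)%:R * bernoulli k = 0.
Proof.
case: n => // n _; rewrite big_mkord big_ord_recr /=.
rewrite {2}/bernoulli /= nth_rcons size_bernoulli_seq ltnn eqxx binSn.
rewrite mulrN mulrA mulfV ?Num.Theory.pnatr_eq0 // mul1r.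
apply/eqP; rewrite subr_eq0; apply/eqP; apply: eq_bigr => k _.
by rewrite nth_bernoulli_seq // -ltnS.
Qed.

(* a = b (mod p^2) for rationals whose denominators are coprime to p. *)
Definition eqmod_sqr (p : nat) (a b : rat) : bool :=
  [&& coprimez (denq a) p, coprimez (denq b) p
    & ((p ^ 2)%N%:Z %| numq (a - b))%Z].

(* Main.v *)
Require Import Defs.
From HB Require Import structures.
From mathcomp Require Import all_boot all_order all_algebra.
From mathcomp Require Import cyclic.
From mathcomp Require Import ring zify.

(* Summation by parts evaluates sum_(k < p) k^r H_k^3 exactly as a polynomial
   in p, H_{p-1} and H^(2)_{p-1} = sum_(k < p) 1/k^2, so everything reduces to
   H_{p-1} = 0 and H^(2)_{p-1} = (2/3) p B_{p-3} mod p^2.  Both follow from the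
   identities
     sum_k (-1)^k C(n,k)/k = - H_n,
     sum_k (-1)^k C(n,k)/k^2 = - (H_n^2 + H^(2)_n)/2
   at n = p - 1, where (-1)^k C(p-1,k) = 1 - p H_k mod p^2: the second one gives
   (3/2) H^(2)_{p-1} = p sum_k H_k/k^2 mod p^2, and that last sum is B_{p-3}
   mod p by Fermat's theorem and Faulhaber's formula for sum_(i < k) i^(p-2). *)

Set Implicit Arguments.
Unset Strict Implicit.
Unset Printing Implicit Defensive.
Import Order.TTheory GRing.Theory Num.Theory.
Local Open Scope ring_scope.

(** * Localization at p and congruences modulo powers of p *)

(** Since [numq x] and [denq x] are coprime, [denq x] divides any d that clears the denominator of
    x. Integrality at p can thus be tested on unreduced fractions. *)
Lemma coprimez_denq_den (p d : nat) (x : rat) (z : int) :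
  x * d%:R = z%:~R -> coprime d p -> coprimez (denq x) p.
Proof.
move=> xd cdp; have: (denq x %| numq x * d%:Z)%Z.
  apply/dvdzP; exists z; apply/eqP; rewrite -(eqr_int rat) !intrM numqE -xd.
  by rewrite mulrAC.
rewrite Gauss_dvdzr; last by rewrite coprimez_sym; exact: coprime_num_den.
by rewrite dvdzE coprimezE => /coprime_dvdl; apply.
Qed.

(* The localization of the integers at p, as a subring of rat. *)
Definition pint (p : nat) : {pred rat} := fun x => coprimez (denq x) p.

Lemma pintP p (x : rat) :
  reflect (exists2 d : nat, coprime d p & exists z : int, x * d%:R = z%:~R)
          (x \in pint p).
Proof.
apply: (iffP idP) => [px|[d cdp [z xd]]]; last exact: coprimez_denq_den xd cdp.
exists `|denq x|%N => //; exists (numq x).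
by rewrite numqE natr_absz normr_denq.
Qed.

Lemma pint_subring p : subring_closed (pint p).
Proof.
split=> [|x y|x y]; first by apply/pintP; exists 1%N; [exact: coprime1n | exists 1].
- move=> /pintP[d cd [z xz]] /pintP[e ce [t yt]]; apply/pintP.
  exists (d * e)%N; first by rewrite coprimeMl cd.
  exists (z * e%:Z - t * d%:Z).
  rewrite intrB !intrM -xz -yt natrM !pmulrn; ring.
- move=> /pintP[d cd [z xz]] /pintP[e ce [t yt]]; apply/pintP.
  exists (d * e)%N; first by rewrite coprimeMl cd.
  exists (z * t); rewrite intrM -xz -yt natrM; ring.
Qed.

HB.instance Definition _ p :=
  GRing.isSubringClosed.Build rat (pint p) (pint_subring p).

Lemma pint_inv p n : coprime n p -> n%:R^-1 \in pint p.
Proof.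
case: n => [|n] cnp; first by rewrite invr0 rpred0.
by apply/pintP; exists n.+1 => //; exists 1; rewrite mulVf ?pnatr_eq0.
Qed.

(* x = y modulo p ^ e in the localization of the integers at p. *)
Definition eqpow (p e : nat) (x y : rat) := (x - y) / p%:R ^+ e \in pint p.

Lemma eqpow_refl p e x : eqpow p e x x.
Proof. by rewrite /eqpow subrr mul0r rpred0. Qed.

Lemma eqpow_eq p e x y : x = y -> eqpow p e x y.
Proof. by move=> ->; apply: eqpow_refl. Qed.

Lemma eqpow_sym p e x y : eqpow p e x y -> eqpow p e y x.
Proof. by rewrite /eqpow -opprB mulNr rpredN. Qed.

Lemma eqpow_trans p e y x z : eqpow p e x y -> eqpow p e y z -> eqpow p e x z.
Proof.
rewrite /eqpow => xy yz.
rewrite -[x](subrK y) -addrA mulrDl; exact: rpredD.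
Qed.

Lemma eqpowD p e x y x' y' :
  eqpow p e x x' -> eqpow p e y y' -> eqpow p e (x + y) (x' + y').
Proof.
by rewrite /eqpow => xx yy; rewrite opprD addrACA mulrDl rpredD.
Qed.

Lemma eqpowMl p e z x x' :
  z \in pint p -> eqpow p e x x' -> eqpow p e (z * x) (z * x').
Proof. by rewrite /eqpow => pz xx; rewrite -mulrBr -mulrA rpredM. Qed.

Lemma eqpow_sum p e (I : eqType) (r : seq I) (P : pred I) (F G : I -> rat) :
  (forall i, i \in r -> P i -> eqpow p e (F i) (G i)) ->
  eqpow p e (\sum_(i <- r | P i) F i) (\sum_(i <- r | P i) G i).
Proof.
move=> FG; rewrite big_seq_cond [X in eqpow _ _ _ X]big_seq_cond.
apply: (big_ind2 (eqpow p e)) => [|*|i /andP[]];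
  [exact: eqpow_refl | exact: eqpowD | exact: FG].
Qed.

Lemma eqpow_sum_nat p e m n (F G : nat -> rat) :
  (forall i, (m <= i < n)%N -> eqpow p e (F i) (G i)) ->
  eqpow p e (\sum_(m <= i < n) F i) (\sum_(m <= i < n) G i).
Proof. by move=> FG; apply: eqpow_sum => i + _; rewrite mem_index_iota => /FG. Qed.

(** Bridge to the target statement. Integrality of x follows from that of y, as x differs from y by
    p^2 times a p-integral number. *)
Lemma eqpow2_eqmod_sqr p x y : (0 < p)%N -> y \in pint p ->
  eqpow p 2 x y -> eqmod_sqr p x y.
Proof.
move=> p0 py xy; set z := (x - y) / p%:R ^+ 2 in xy.
have xyE : x - y = p%:R ^+ 2 * z.
  by rewrite mulrC divfK // expf_neq0 // pnatr_eq0 -lt0n.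
have px : x \in pint p.
  by rewrite -(subrK y x) xyE rpredD // rpredM // rpredX // rpred_nat.
apply/and3P; split=> //.
(* Cross-multiplying x - y = p^2 z gives this divisibility; [denq z] is coprime to p and cancels by
   Gauss's lemma. *)
have : ((p ^ 2)%N%:Z %| numq (x - y) * denq z)%Z.
  apply/dvdzP; exists (numq z * denq (x - y)); apply/eqP.
  rewrite -(eqr_int rat) !intrM !numqE xyE -pmulrn natrX; apply/eqP; ring.
rewrite Gauss_dvdzl // coprimez_sym; rewrite coprimezE; exact: coprimeXr.
Qed.

(** * Harmonic sums and closed forms for the cubic sums *)

(* The upper bound is excluded, so that H_n is [hsum 1 n.+1]. *)
Definition hsum (r n : nat) : rat := \sum_(1 <= k < n) k%:R ^- r.

Lemma hsumS r n : hsum r n.+2 = hsum r n.+1 + n.+1%:R ^- r.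
Proof. by rewrite /hsum big_nat_recr. Qed.

Lemma hsum1 r : hsum r 1 = 0.
Proof. by rewrite /hsum big_geq. Qed.

Lemma harmonicE n : harmonic n = hsum 1 n.+1.
Proof. by []. Qed.

(** Expanding H_n^2 as a double sum of 1/(ij), the pairs i <= j and i >= j contribute equally and
    share the diagonal H^(2)_n. *)
Lemma sum_harmonic_div n (h := hsum 1 n.+1) (g := hsum 2 n.+1) :
  \sum_(1 <= k < n.+1) harmonic k / k%:R = (h ^+ 2 + g) / 2.
Proof.
subst h g; elim: n => [|m IHm]; first by rewrite big_geq // !hsum1; field.
have m0 : 1 + m%:R != 0 :> rat by rewrite nat1r pnatr_eq0.
by rewrite big_nat_recr //= IHm harmonicE !hsumS; field.
Qed.

(** With x = n + 1, the case n = p - 1 has x = p. Once the closed form is known, each induction step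
    is a rational identity in n, H_n and H^(2)_n. *)
Lemma sum_harmonic3_0 n (x : rat := n.+1%:R)
    (h := hsum 1 n.+1) (g := hsum 2 n.+1) :
  \sum_(1 <= k < n.+1) harmonic k ^+ 3 =
    x * h ^+ 3 + (3 / 2 - 3 * x) * h ^+ 2 + (6 * x - 3) * h + g / 2 + 6 - 6 * x.
Proof.
subst x h g; elim: n => [|m IHm]; first by rewrite big_geq // !hsum1; field.
have m0 : 1 + m%:R != 0 :> rat by rewrite nat1r pnatr_eq0.
by rewrite big_nat_recr //= IHm harmonicE !hsumS -(addn1 m.+1) natrD; field.
Qed.

Lemma sum_harmonic3_1 n (x : rat := n.+1%:R)
    (h := hsum 1 n.+1) (g := hsum 2 n.+1) :
  \sum_(1 <= k < n.+1) k%:R * harmonic k ^+ 3 =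
    (x ^+ 2 / 2 - x / 2) * h ^+ 3
    + (9 / 4 * x - 3 / 4 - 3 / 4 * x ^+ 2) * h ^+ 2
    + (7 / 4 - 15 / 4 * x + 3 / 4 * x ^+ 2) * h
    - g / 4 - 3 + 27 / 8 * x - 3 / 8 * x ^+ 2.
Proof.
subst x h g; elim: n => [|m IHm]; first by rewrite big_geq // !hsum1; field.
have m0 : 1 + m%:R != 0 :> rat by rewrite nat1r pnatr_eq0.
by rewrite big_nat_recr //= IHm harmonicE !hsumS -(addn1 m.+1) natrD; field.
Qed.

Lemma sum_harmonic3_2 n (x : rat := n.+1%:R)
    (h := hsum 1 n.+1) (g := hsum 2 n.+1) :
  \sum_(1 <= k < n.+1) k%:R ^+ 2 * harmonic k ^+ 3 =
    (x / 6 - x ^+ 2 / 2 + x ^+ 3 / 3) * h ^+ 3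
    + (1 / 4 - 17 / 12 * x + 5 / 4 * x ^+ 2 - x ^+ 3 / 3) * h ^+ 2
    + (79 / 36 * x - 11 / 12 - 13 / 12 * x ^+ 2 + 2 / 9 * x ^+ 3) * h
    + g / 12 + 23 / 18 - 365 / 216 * x + 35 / 72 * x ^+ 2 - 2 / 27 * x ^+ 3.
Proof.
subst x h g; elim: n => [|m IHm]; first by rewrite big_geq // !hsum1; field.
have m0 : 1 + m%:R != 0 :> rat by rewrite nat1r pnatr_eq0.
by rewrite big_nat_recr //= IHm harmonicE !hsumS -(addn1 m.+1) natrD; field.
Qed.

(** For r = 0, 1, 2, 3 the coefficient of H^(2) in the closed form is B_r / 2. It vanishes for r =
    3, hence no B_{p-3} in the fourth congruence. *)
Lemma sum_harmonic3_3 n (x : rat := n.+1%:R) (h := hsum 1 n.+1) :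
  \sum_(1 <= k < n.+1) k%:R ^+ 3 * harmonic k ^+ 3 =
    (x ^+ 2 / 4 - x ^+ 3 / 2 + x ^+ 4 / 4) * h ^+ 3
    + (5 / 8 * x - 21 / 16 * x ^+ 2 + 7 / 8 * x ^+ 3 - 3 / 16 * x ^+ 4) * h ^+ 2
    + (3 / 8 - 59 / 48 * x + 37 / 32 * x ^+ 2 - 25 / 48 * x ^+ 3
       + 3 / 32 * x ^+ 4) * h
    - 5 / 12 + 425 / 576 * x - 175 / 384 * x ^+ 2 + 91 / 576 * x ^+ 3
    - 3 / 128 * x ^+ 4.
Proof.
subst x h; elim: n => [|m IHm]; first by rewrite big_geq // !hsum1; field.
have m0 : 1 + m%:R != 0 :> rat by rewrite nat1r pnatr_eq0.
by rewrite big_nat_recr //= IHm harmonicE !hsumS -(addn1 m.+1) natrD; field.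
Qed.

(** * Alternating binomial sums *)

Definition altbin_sum (r n : nat) : rat :=
  \sum_(1 <= k < n.+1) (-1) ^+ k * 'C(n, k)%:R / k%:R ^+ r.

(** The binomial expansion of (1 - 1)^(n+1) = 0 without its term 1 at k = 0. *)
Lemma altbin_sum0 n : altbin_sum 0 n.+1 = -1.
Proof.
have := exprDn (1 : rat) (-1) n.+1; rewrite subrr expr0n /=.
under eq_bigr => i _ do rewrite expr1n mul1r -mulr_natr.
rewrite -(big_mkord xpredT (fun i => (-1) ^+ i * 'C(n.+1, i)%:R)).
rewrite big_ltn // bin0 expr0 mul1r => /eqP.
rewrite eq_sym addrC addr_eq0 => /eqP <-.
by apply: eq_bigr => i _; rewrite expr0 divr1.
Qed.

(** Pascal's rule splits C(n+1, k), and the absorption identity C(n, k-1) / k = C(n+1, k) / (n+1)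
    trades one factor 1/k for 1/(n+1). *)
Lemma altbin_sumS r n :
  altbin_sum r.+1 n.+1 = altbin_sum r.+1 n + altbin_sum r n.+1 / n.+1%:R.
Proof.
have n0 : n.+1%:R != 0 :> rat by rewrite pnatr_eq0.
have -> : altbin_sum r.+1 n =
    \sum_(1 <= k < n.+2) (-1) ^+ k * 'C(n, k)%:R / k%:R ^+ r.+1.
  by rewrite big_nat_recr //= bin_small // mulr0 mul0r addr0.
rewrite /altbin_sum mulr_suml -big_split /=; apply: eq_big_nat => k /andP[k1 _].
case: k k1 => // k _.
have k0 : k.+1%:R != 0 :> rat by rewrite pnatr_eq0.
have E : 'C(n.+1, k.+1)%:R / n.+1%:R = 'C(n, k)%:R / k.+1%:R :> rat.
  apply/eqP; rewrite eqr_div // -!natrM; apply/eqP; congr _%:R.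
  by rewrite mulnC -mul_bin_diag mulnC.
rewrite [X in _ + X]mulrAC -[X in _ + X / _]mulrA E binS natrD !exprS.
by field; rewrite nat1r k0 expf_neq0.
Qed.

Lemma altbin_sum1 n : altbin_sum 1 n = - hsum 1 n.+1.
Proof.
elim: n => [|n IHn]; first by rewrite hsum1 /altbin_sum big_geq // oppr0.
by rewrite altbin_sumS IHn altbin_sum0 hsumS mulN1r opprD.
Qed.

(** By [altbin_sum1] the increments are - H_{n+1} / (n+1), which are also those of the right-hand
    side. *)
Lemma altbin_sum2 n :
  altbin_sum 2 n = - ((hsum 1 n.+1 ^+ 2 + hsum 2 n.+1) / 2).
Proof.
elim: n => [|n IHn]; first by rewrite !hsum1 /altbin_sum big_geq //; ring.
have n0 : 1 + n%:R != 0 :> rat by rewrite nat1r pnatr_eq0.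
by rewrite altbin_sumS IHn altbin_sum1 !hsumS; field.
Qed.

(** * Faulhaber's formula *)

Lemma bernoulli_rec_trunc n :
  \sum_(j < n.+1) 'C(n.+1, j)%:R * bernoulli j = (n == 0%N)%:R.
Proof.
case: n => [|n]; first by rewrite big_ord1 bin0 mul1r.
by rewrite -(big_mkord xpredT (fun j => 'C(n.+2, j)%:R * bernoulli j)) bernoulli_rec.
Qed.

(** Both sides are the trinomial coefficient n! / (i! j! (n-i-j)!). *)
Lemma mul_bin_trinomial n i j : (i + j <= n)%N ->
  ('C(n, j) * 'C(n - j, i) = 'C(n, i) * 'C(n - i, j))%N.
Proof.
move=> ijn.
have jn : (j <= n)%N by apply: leq_trans ijn; rewrite leq_addl.
have inn : (i <= n)%N by apply: leq_trans ijn; rewrite leq_addr.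
have ij : (i <= n - j)%N by rewrite leq_subRL // addnC.
have ji : (j <= n - i)%N by rewrite leq_subRL.
have f0 : (0 < i`! * j`! * (n - i - j)`!)%N by rewrite !muln_gt0 !fact_gt0.
apply/eqP; rewrite -(eqn_pmul2r f0); apply/eqP.
have E1 := bin_fact jn; have E2 := bin_fact inn.
have E3 := bin_fact ij; have E4 := bin_fact ji.
transitivity n`!.
  by rewrite -{1}E1 -E3 -!subnDA addnC; ring.
by rewrite -{1}E2 -E4; ring.
Qed.

(** Induction on n: the increment of the right-hand side is expanded in powers n^i, and the
    Bernoulli recurrence kills every coefficient except that of n^m. *)
Lemma faulhaber m n :
  m.+1%:R * \sum_(0 <= i < n) i%:R ^+ m =
  \sum_(j < m.+1) 'C(m.+1, j)%:R * bernoulli j * n%:R ^+ (m.+1 - j) :> rat.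
Proof.
elim: n => [|n IHn].
  rewrite big_geq // mulr0 big1 // => j _.
  by rewrite expr0n subn_eq0 leqNgt ltn_ord mulr0.
rewrite big_nat_recr //= mulrDr IHn; apply/eqP.
rewrite addrC eq_sym -subr_eq -sumrB; apply/eqP.
(* The top power i = m + 1 - j of (n+1)^(m+1-j) cancels against the old term, leaving i + j < m +
   1. *)
transitivity (\sum_(j < m.+1) \sum_(i < m.+1 | (i + j < m.+1)%N)
    'C(m.+1, i)%:R * n%:R ^+ i * ('C(m.+1 - i, j)%:R * bernoulli j) : rat).
  apply: eq_bigr => [[j jm]] _ /=; rewrite -mulrBr -(nat1r n) exprDn.
  have -> : (m.+1 - j = (m - j).+1)%N by rewrite subSn // -ltnS.
  rewrite big_ord_recr /= subnn expr0 mul1r binn mulr1n addrK mulr_sumr.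
  pose F i : rat := 'C(m.+1, i)%:R * n%:R ^+ i * ('C(m.+1 - i, j)%:R * bernoulli j).
  transitivity (\sum_(i < (m - j).+1) F i).
    apply: eq_bigr => i _; rewrite expr1n mul1r -mulr_natr /F.
    have E : (i + j <= m.+1)%N.
      by rewrite addnC -leq_subRL 1?ltnW // subSn // ltnW.
    have := mul_bin_trinomial E; rewrite subSn //.
    move/(congr1 (fun k => k%:R : rat)); rewrite !natrM => E'.
    transitivity (('C(m.+1, j)%:R * 'C((m - j).+1, i)%:R) * bernoulli j * n%:R ^+ i).
      by ring.
    by rewrite E'; ring.
  rewrite (big_ord_widen m.+1 F) ?ltnS ?leq_subr //; apply: eq_bigl => i.
  by rewrite !ltnS addnC leq_subRL.
(* The index i = m is split off: there only j = 0 remains, which gives (m+1) n^m. For i < m the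
   inner sum over j is the recurrence of order m - i > 0. *)
rewrite (exchange_big_dep xpredT) //= big_ord_recr /=.
rewrite [X in X + _]big1 => [|i _].
  rewrite add0r (bigD1 ord0) ?addn0 //= big1 ?addr0.
    by rewrite bin0 bernoulli0 !mulr1 binSn.
  move=> j /andP[]; rewrite -[X in (_ < X)%N]addn1 ltn_add2l ltnS leqn0.
  by move=> /eqP jj /eqP[]; apply: val_inj.
rewrite -mulr_sumr.
have := bernoulli_rec_trunc (m - i); rewrite subn_eq0 leqNgt ltn_ord /= => E.
rewrite -[RHS](mulr0 ('C(m.+1, i)%:R * n%:R ^+ i)); congr (_ * _).
apply: etrans E.
have im : (i <= m)%N by rewrite ltnW.
rewrite (big_ord_widen m.+1 (fun j => 'C((m - i).+1, j)%:R * bernoulli j));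
  rewrite ?ltnS ?leq_subr //.
by rewrite subSn //; apply: eq_bigl => j; rewrite !ltnS leq_subRL.
Qed.

(** * Power sums and Bernoulli numbers modulo p *)

Lemma eqpowP p e x y : (0 < p)%N ->
  reflect (exists2 z, z \in pint p & x = y + p%:R ^+ e * z) (eqpow p e x y).
Proof.
move=> p0; have pe0 : p%:R ^+ e != 0 :> rat by rewrite expf_neq0 // pnatr_eq0 -lt0n.
apply: (iffP idP) => [xy|[z pz ->]]; last first.
  by rewrite /eqpow addrAC subrr add0r mulrAC divff // mul1r.
by exists ((x - y) / p%:R ^+ e); rewrite // mulrC divfK // addrC subrK.
Qed.

Lemma pint_inv_lt p k : prime p -> (0 < k < p)%N -> k%:R^-1 \in pint p.
Proof.
move=> pp /andP[k0 kp]; apply: pint_inv.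
by rewrite coprime_sym prime_coprime // gtnNdvd.
Qed.

(** The recurrence expresses B_j through earlier terms, dividing only by j + 1, which is a unit at p
    while j + 1 < p. *)
Lemma bernoulli_pint p j : prime p -> (j.+1 < p)%N -> bernoulli j \in pint p.
Proof.
move=> pp; elim/ltn_ind: j => j IHj; case: j IHj => [|j] IHj jp.
  by rewrite bernoulli0 rpred1.
have j0 : j.+2%:R != 0 :> rat by rewrite pnatr_eq0.
have := bernoulli_rec_trunc j.+1; rewrite big_ord_recr /= => /eqP.
rewrite addrC addr_eq0 binSn => /eqP E.
rewrite -(mulKf j0 (bernoulli _)) {}E rpredM ?pint_inv_lt // rpredN rpred_sum //.
by move=> i _; rewrite rpredM ?rpred_nat // IHj // (leq_ltn_trans _ jp) // ltnS ltnW.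
Qed.

(** In Faulhaber's formula at n = p every exponent m + 1 - j is positive, so each term has a factor
    p, and the coefficients are p-integral. *)
Lemma power_sum_modp p m : prime p -> (0 < m)%N -> (m.+1 < p)%N ->
  eqpow p 1 (\sum_(1 <= k < p) k%:R ^+ m) 0.
Proof.
move=> pp m0 mp; have p0 := prime_gt0 pp.
have p0' : p%:R != 0 :> rat by rewrite pnatr_eq0 -lt0n.
have m1 : m.+1%:R != 0 :> rat by rewrite pnatr_eq0.
have := faulhaber m p; rewrite big_ltn // expr0n eqn0Ngt m0 add0r => E.
rewrite /eqpow subr0 -(mulKf m1 (\sum_(1 <= k < p) _)) {}E -mulrA.
rewrite rpredM ?pint_inv_lt // mulr_suml rpred_sum // => j _.
rewrite subSn; last by rewrite -ltnS.
rewrite exprSr mulrA expr1 mulfK // !rpredM ?rpredX ?rpred_nat //.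
by rewrite bernoulli_pint // (leq_ltn_trans _ mp).
Qed.

Lemma fermat_eqpow p k : prime p -> (0 < k < p)%N ->
  eqpow p 1 (k%:R ^+ p.-1) 1.
Proof.
move=> pp /andP[k0 kp].
have p0' : p%:R != 0 :> rat by rewrite pnatr_eq0 -lt0n prime_gt0.
have ckp : coprime k p by rewrite coprime_sym prime_coprime // gtnNdvd.
have := Euler_exp_totient ckp; rewrite totient_prime // => /eqP.
rewrite eqn_mod_dvd ?expn_gt0 ?k0 // => /dvdnP[c E].
rewrite /eqpow -natrX -(natrB _ (_ : 1 <= k ^ p.-1)%N) ?expn_gt0 ?k0 // E natrM.
by rewrite mulfK // rpred_nat.
Qed.

(** Fermat's theorem turns inverse powers into the nonnegative powers that Faulhaber's formula
    handles. *)
Lemma exprN_eqpow p k r : prime p -> (0 < k < p)%N -> (r <= p.-1)%N ->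
  eqpow p 1 (k%:R ^- r) (k%:R ^+ (p.-1 - r)).
Proof.
move=> pp kp rp.
have k0 : k%:R != 0 :> rat by rewrite pnatr_eq0 -lt0n; case/andP: kp.
have -> : k%:R ^+ (p.-1 - r) = k%:R ^- r * k%:R ^+ p.-1 :> rat.
  by rewrite -{2}(subnK rp) exprD mulrCA mulVf ?mulr1 // expf_neq0.
rewrite -{1}[_ ^- r]mulr1; apply: eqpowMl.
  by rewrite -exprVn rpredX // pint_inv_lt.
by apply: eqpow_sym; apply: fermat_eqpow.
Qed.

Lemma hsum_modp p r : prime p -> (0 < r < p.-1)%N -> eqpow p 1 (hsum r p) 0.
Proof.
move=> pp /andP[r0 rp].
apply: eqpow_trans (power_sum_modp pp (_ : 0 < p.-1 - r)%N _).
- by apply: eqpow_sum_nat => k kp; apply: exprN_eqpow => //; apply: ltnW.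
- by rewrite subn_gt0.
- by lia.
Qed.

Lemma pint_hsum p r n : prime p -> (n <= p)%N -> hsum r n \in pint p.
Proof.
move=> pp np; rewrite /hsum big_nat rpred_sum // => k /andP[k1 kn].
by rewrite -exprVn rpredX // pint_inv_lt // k1 (leq_trans kn).
Qed.

(** Here [hsum 1 k] is H_{k-1}, congruent to the sum of i^(p-2) over i < k. Faulhaber's formula
    makes this a polynomial in k; after division by k^2 and summation over k, only its k^2 term
    survives modulo p. *)
Lemma sum_hsum_modp p : prime p -> (3 < p)%N ->
  eqpow p 1 (\sum_(1 <= k < p) hsum 1 k / k%:R ^+ 2) (bernoulli (p - 3)).
Proof.
move=> pp p3; have p0 := prime_gt0 pp.
case: p pp p3 p0 => [|[|[|q]]] // pp p3 p0.
rewrite -[(q.+3 - 3)%N]/(q.+1.+2 - 3)%N subSS subSS subSS subn0.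
pose F k : rat := \sum_(0 <= i < k) i%:R ^+ q.+1.
have q2 : q.+2%:R != 0 :> rat by rewrite pnatr_eq0.
have q2V : q.+2%:R^-1 \in pint q.+3 by rewrite pint_inv_lt // ltnSn.
apply: (@eqpow_trans _ _ (\sum_(1 <= k < q.+3) F k / k%:R ^+ 2)).
  apply: eqpow_sum_nat => k kp; rewrite ![_ / _]mulrC; apply: eqpowMl.
    by rewrite -exprVn rpredX // pint_inv_lt.
  case/andP: kp => k1 kp; rewrite /F big_ltn // expr0n add0r.
  apply: eqpow_sum_nat => i /andP[i1 ik].
  by have := @exprN_eqpow q.+3 i 1 pp; rewrite subn1; apply;
    rewrite ?i1 ?(ltn_trans ik).
have -> : \sum_(1 <= k < q.+3) F k / k%:R ^+ 2 = q.+2%:R^-1 *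
    \sum_(j < q.+2) 'C(q.+2, j)%:R * bernoulli j *
        \sum_(1 <= k < q.+3) k%:R ^+ (q.+2 - j) / k%:R ^+ 2.
  under [X in _ = _ * X]eq_bigr do rewrite mulr_sumr.
  rewrite exchange_big mulr_sumr; apply: eq_bigr => k _.
  rewrite -(mulKf q2 (F k)) faulhaber -mulrA; congr (_ * _).
  by rewrite mulr_suml; apply: eq_bigr => j _; rewrite mulrA.
(* With q = p - 3, index j leads to the sum of k^(q-j): a vanishing power sum for j < q, p - 1 for j
   = q, and H_{p-1} for j = q + 1. *)
apply: (@eqpow_trans _ _ (q.+2%:R^-1 * ('C(q.+2, q)%:R * bernoulli q * q.+2%:R))).
  apply: eqpowMl => //; rewrite !big_ord_recr /=.
  rewrite -[X in eqpow _ _ _ X]add0r -[X in eqpow _ _ _ X]addr0.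
  apply: eqpowD; first apply: eqpowD.
  - have Z : \sum_(j < q) 0 = 0 :> rat by rewrite big1.
    rewrite -[X in eqpow _ _ _ X]Z.
    apply: eqpow_sum => j _ _.
    rewrite -[X in eqpow _ _ _ X](mulr0 ('C(q.+2, j)%:R * bernoulli j)).
    apply: eqpowMl.
      rewrite rpredM ?rpred_nat // bernoulli_pint //.
      by apply: leq_ltn_trans (ltn_ord j) _; rewrite ltnS ltnW.
    have jq := ltn_ord j.
    rewrite (eq_big_nat _ _ (F2 := fun k => k%:R ^+ (q - j))); last first.
      move=> k /andP[k1 _]; have k0 : k%:R != 0 :> rat by rewrite pnatr_eq0 -lt0n.
      by rewrite -addn2 -addnBAC 1?ltnW // exprD mulfK // expf_neq0.
    by apply: power_sum_modp => //; lia.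
  - apply: eqpow_eq; congr (_ * _).
    rewrite (eq_big_nat _ _ (F2 := fun => 1)); first by rewrite sumr_const_nat subn1.
    move=> k /andP[k1 _]; have k0 : k%:R != 0 :> rat by rewrite pnatr_eq0 -lt0n.
    by rewrite -addn2 addKn divff // expf_neq0.
  - rewrite -[X in eqpow _ _ _ X](mulr0 ('C(q.+2, q.+1)%:R * bernoulli q.+1)).
    apply: eqpowMl; first by rewrite rpredM ?rpred_nat // bernoulli_pint.
    rewrite (eq_big_nat _ _ (F2 := fun k => k%:R ^- 1)); last first.
      move=> k /andP[k1 _]; have k0 : k%:R != 0 :> rat by rewrite pnatr_eq0 -lt0n.
      by rewrite subSnn !expr1; field.
    by apply: hsum_modp.
rewrite mulrC mulfK //.
(* The witness comes from C(p-1, 2) = 1 + p (p-3) / 2. *)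
apply/(eqpowP _ _ _ p0); exists (bernoulli q * (q%:R * 2%:R^-1)).
  rewrite !rpredM ?rpred_nat ?bernoulli_pint ?pint_inv_lt //.
have -> : 'C(q.+2, q)%:R = q.+2%:R * q.+1%:R / 2 :> rat.
  apply/eqP; rewrite eq_sym -[_ == _](inj_eq (mulIf (_ : 2%:R != 0 :> rat))) // divfK //.
  rewrite -!natrM eqr_nat; apply/eqP.
  by have := bin_ffact q.+2 2; rewrite -bin_sub // subn2 /= !ffactnSr ffactn0 => ->;
    rewrite mul1n subn0 subn1.
by rewrite expr1 -!natr1; field.
Qed.

(** Passing from H_{k-1} to H_k adds H^(3)_{p-1}, which vanishes modulo p. *)
Lemma sum_harmonic_sqr_modp p : prime p -> (3 < p)%N ->
  eqpow p 1 (\sum_(1 <= k < p) harmonic k / k%:R ^+ 2) (bernoulli (p - 3)).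
Proof.
move=> pp p3; rewrite -[X in eqpow _ _ _ X]addr0.
(* [hsum_modp] at r = 3 requires 3 < p - 1; the value p = 4 is not prime. *)
have p5 : (4 < p)%N by rewrite ltn_neqAle p3 andbT; apply: contraTneq pp => <-.
have h3 : eqpow p 1 (hsum 3 p) 0 by apply: hsum_modp => //; lia.
apply: eqpow_trans (eqpowD (sum_hsum_modp pp p3) h3).
apply: eqpow_eq; rewrite -big_split /=; apply: eq_big_nat => k /andP[].
case: k => // k _ _; rewrite harmonicE hsumS; field.
by rewrite nat1r pnatr_eq0.
Qed.

(** * H_{p-1} and H^(2)_{p-1} modulo p^2 *)

(** The left-hand side is the product of 1 - p/i for i <= k; modulo p^2 only the part linear in p
    remains. *)
Lemma altbin_modp2 p k : prime p -> (k < p)%N ->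
  eqpow p 2 ((-1) ^+ k * 'C(p.-1, k)%:R) (1 - p%:R * hsum 1 k.+1).
Proof.
move=> pp; have p0 := prime_gt0 pp.
elim: k => [|k IHk] kp.
  by apply: eqpow_eq; rewrite hsum1 bin0; ring.
have k0 : 1 + k%:R != 0 :> rat by rewrite nat1r pnatr_eq0.
have kV : k.+1%:R^-1 \in pint p by rewrite pint_inv_lt.
have E : (-1) ^+ k.+1 * 'C(p.-1, k.+1)%:R =
    (1 - p%:R * k.+1%:R^-1) * ((-1) ^+ k * 'C(p.-1, k)%:R) :> rat.
  have := mul_bin_left p.-1 k => /(congr1 (fun m => m%:R : rat)).
  rewrite !natrM natrB; last by lia.
  rewrite -subn1 natrB // => E.
  have -> : 'C(p - 1, k.+1)%:R = (p%:R - 1 - k%:R) * 'C(p - 1, k)%:R / k.+1%:R :> rat.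
    by rewrite -E mulrAC divff ?mul1r // pnatr_eq0.
  by rewrite exprS; field.
rewrite {}E; apply: (eqpow_trans (eqpowMl _ (IHk (ltnW kp)))).
  by rewrite rpredB ?rpred1 // rpredM ?rpred_nat.
(* The cross term of (1 - p/(k+1)) (1 - p H_k). *)
apply/(eqpowP _ _ _ p0); exists (k.+1%:R^-1 * hsum 1 k.+1).
  by rewrite rpredM // pint_hsum // ltnW.
by rewrite hsumS; field.
Qed.

Lemma altbin_sum_modp2 p r : prime p ->
  eqpow p 2 (altbin_sum r p.-1)
    (hsum r p - p%:R * \sum_(1 <= k < p) harmonic k / k%:R ^+ r).
Proof.
move=> pp; rewrite /altbin_sum prednK ?prime_gt0 //.
rewrite mulr_sumr -sumrB; apply: eqpow_sum_nat => k kp.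
have -> : k%:R ^- r - p%:R * (harmonic k / k%:R ^+ r) =
    k%:R ^- r * (1 - p%:R * hsum 1 k.+1) :> rat by rewrite harmonicE; ring.
rewrite [_ / _]mulrC; apply: eqpowMl; first by rewrite -exprVn rpredX // pint_inv_lt.
by apply: altbin_modp2 => //; case/andP: kp.
Qed.

(** Wolstenholme's theorem. The two values of the alternating sum give 2 H = p (H^2 + H^(2)) / 2
    modulo p^2, where H and H^(2) are already divisible by p. *)
Lemma hsum1_modp2 p : prime p -> (3 < p)%N -> eqpow p 2 (hsum 1 p) 0.
Proof.
move=> pp p3; have p0 := prime_gt0 pp.
have V2 : 2%:R^-1 \in pint p by rewrite pint_inv_lt // (ltn_trans _ p3).
have /(eqpowP _ _ _ p0)[a pa Ea] : eqpow p 1 (hsum 1 p) 0 by apply: hsum_modp => //; lia.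
have /(eqpowP _ _ _ p0)[b pb Eb] : eqpow p 1 (hsum 2 p) 0 by apply: hsum_modp => //; lia.
have /(eqpowP _ _ _ p0)[c pc] := altbin_sum_modp2 1 pp.
rewrite altbin_sum1 prednK //.
have := sum_harmonic_div p.-1; rewrite /= prednK // => -> Ec.
apply/(eqpowP _ _ _ p0); exists (2%:R^-1 * (2%:R^-1 * (p%:R * a ^+ 2 + b) - c)).
  by rewrite rpredM // rpredB // rpredM // rpredD // rpredM ?rpred_nat // rpredX.
have -> : hsum 1 p = 2^-1 * (hsum 1 p - - hsum 1 p) by field.
by rewrite Ec Eb Ea; field.
Qed.

(** Equating the two values gives (3/2) H^(2) = p S - H^2 / 2 modulo p^2, with S the sum of H_k /
    k^2. The factor p means S is needed only modulo p, and H^2 is divisible by p^4. *)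
Lemma hsum2_modp2 p : prime p -> (3 < p)%N ->
  eqpow p 2 (hsum 2 p) (2 / 3 * p%:R * bernoulli (p - 3)).
Proof.
move=> pp p3; have p0 := prime_gt0 pp.
have V3 : 3%:R^-1 \in pint p by rewrite pint_inv_lt.
have /(eqpowP _ _ _ p0)[a pa Ea] := hsum1_modp2 pp p3.
have /(eqpowP _ _ _ p0)[t pt Et] := sum_harmonic_sqr_modp pp p3.
have /(eqpowP _ _ _ p0)[c pc] := altbin_sum_modp2 2 pp.
rewrite altbin_sum2 prednK // Ea {}Et => Ec.
apply/(eqpowP _ _ _ p0); exists (3%:R^-1 * (2 * t - 2 * c - p%:R ^+ 2 * a ^+ 2)).
  by rewrite rpredM // !rpredB // rpredM ?rpred_nat ?rpredX ?rpred_nat.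
have -> : hsum 2 p =
    - (2 / 3) * (- (((0 + p%:R ^+ 2 * a) ^+ 2 + hsum 2 p) / 2) - hsum 2 p)
    - (p%:R ^+ 2 * a) ^+ 2 / 3 by field.
by rewrite Ec; field.
Qed.

(** * The four congruences *)

(** All denominators in the closed forms have only the prime factors 2 and 3. *)
Lemma pint_inv_smooth p a b : prime p -> (3 < p)%N ->
  (2 ^ a * 3 ^ b)%:R^-1 \in pint p.
Proof.
move=> pp p3; apply: pint_inv.
have c k : (0 < k < p)%N -> coprime k p.
  by case/andP=> k0 kp; rewrite coprime_sym prime_coprime // gtnNdvd.
by rewrite coprimeMl !coprimeXl // c //= (ltn_trans _ p3).
Qed.

(* The hypothesis is selected by [constr_eq]: up to conversion, membership of
   different numerals in [pint p] unifies by evaluating the denominators. *)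
Ltac pint_closed :=
  lazymatch goal with
  | |- is_true (_ + _ \in _) => apply: rpredD; pint_closed
  | |- is_true (- _ \in _) => apply: rpredNr; pint_closed
  | |- is_true (_ * _ \in _) => apply: rpredM; pint_closed
  | |- is_true (_ ^+ _ \in _) => apply: rpredX; pint_closed
  | |- is_true (_%:R \in _) => exact (rpred_nat _ _)
  | |- is_true (1 \in _) => exact (rpred1 _)
  | |- is_true (?x \in _) =>
      match goal with H : is_true (?y \in _) |- _ => constr_eq x y; exact H end
  end.

Theorem theorem4p1 (p : nat) (p_prime : prime p) (p_gt3 : (3 < p)%N) :
  [/\ eqmod_sqr p (\sum_(1 <= k < p) harmonic k ^+ 3)
        (1 / 3 * p%:R * bernoulli (p - 3) - 6 * p%:R + 6),
      eqmod_sqr p (\sum_(1 <= k < p) k%:R * harmonic k ^+ 3)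
        (27 / 8 * p%:R - 1 / 6 * p%:R * bernoulli (p - 3) - 3),
      eqmod_sqr p (\sum_(1 <= k < p) k%:R ^+ 2 * harmonic k ^+ 3)
        (- (365 / 216) * p%:R + 1 / 18 * p%:R * bernoulli (p - 3) + 23 / 18)
    & eqmod_sqr p (\sum_(1 <= k < p) k%:R ^+ 3 * harmonic k ^+ 3)
        (425 / 576 * p%:R - 5 / 12)].
Proof.
have p0 := prime_gt0 p_prime.
have pB : bernoulli (p - 3) \in pint p by apply: bernoulli_pint => //; lia.
have /(eqpowP _ _ _ p0)[u pu Eu] := hsum1_modp2 p_prime p_gt3.
have /(eqpowP _ _ _ p0)[w pw Ew] := hsum2_modp2 p_prime p_gt3.
have V a b : (2 ^ a * 3 ^ b)%:R^-1 \in pint p by exact: pint_inv_smooth.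
have V2 : 2^-1 \in pint p := V 1%N 0%N.
have V3 : 3^-1 \in pint p := V 0%N 1%N.
have V4 : 4^-1 \in pint p := V 2%N 0%N.
have V6 : 6^-1 \in pint p := V 1%N 1%N.
have V8 : 8^-1 \in pint p := V 3%N 0%N.
have V9 : 9^-1 \in pint p := V 0%N 2%N.
have V12 : 12^-1 \in pint p := V 2%N 1%N.
have V16 : 16^-1 \in pint p := V 4%N 0%N.
have V18 : 18^-1 \in pint p := V 1%N 2%N.
have V27 : 27^-1 \in pint p := V 0%N 3%N.
have V32 : 32^-1 \in pint p := V 5%N 0%N.
have V36 : 36^-1 \in pint p := V 2%N 2%N.
have V48 : 48^-1 \in pint p := V 4%N 1%N.
have V72 : 72^-1 \in pint p := V 3%N 2%N.
have V128 : 128^-1 \in pint p := V 7%N 0%N.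
have V216 : 216^-1 \in pint p := V 3%N 3%N.
have V384 : 384^-1 \in pint p := V 7%N 1%N.
have V576 : 576^-1 \in pint p := V 6%N 2%N.
have S0 := sum_harmonic3_0 p.-1; have S1 := sum_harmonic3_1 p.-1.
have S2 := sum_harmonic3_2 p.-1; have S3 := sum_harmonic3_3 p.-1.
cbv zeta in S0, S1, S2, S3.
(* Substitutes H = p^2 u and H^(2) = (2/3) p B_{p-3} + p^2 w into the closed forms. *)
rewrite (prednK p0) Eu ?Ew add0r in S0 S1 S2 S3.
set x : rat := p%:R in S0 S1 S2 S3 *; set B := bernoulli _ in pB S0 S1 S2 *.
have px : x \in pint p := rpred_nat _ p.
pose h := x ^+ 2 * u.
have ph : h \in pint p := rpredM (rpredX 2 px) pu.
split; (apply: eqpow2_eqmod_sqr; [exact: p0 | pint_closed | ]).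
- rewrite S0; apply/(eqpowP _ _ _ p0).
  (* The difference divided by p^2: the powers of H share the factor h = p^2 u, and H^(2)
     contributes w / 2. *)
  exists (u * (x * h ^+ 2 + (3 / 2 - 3 * x) * h + (6 * x - 3)) + w / 2).
    pint_closed.
  by rewrite /h; field.
- rewrite S1; apply/(eqpowP _ _ _ p0).
  (* Here and below the pure powers of x from x^2 on, divided by x^2, join the witness. *)
  exists (u * ((x ^+ 2 / 2 - x / 2) * h ^+ 2
    + (9 / 4 * x - 3 / 4 - 3 / 4 * x ^+ 2) * h
    + (7 / 4 - 15 / 4 * x + 3 / 4 * x ^+ 2)) - w / 4 - 3 / 8).
    pint_closed.
  by rewrite /h; field.
- rewrite S2; apply/(eqpowP _ _ _ p0).
  exists (u * ((x / 6 - x ^+ 2 / 2 + x ^+ 3 / 3) * h ^+ 2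
    + (1 / 4 - 17 / 12 * x + 5 / 4 * x ^+ 2 - x ^+ 3 / 3) * h
    + (79 / 36 * x - 11 / 12 - 13 / 12 * x ^+ 2 + 2 / 9 * x ^+ 3))
    + w / 12 + 35 / 72 - 2 / 27 * x).
    pint_closed.
  by rewrite /h; field.
- rewrite S3; apply/(eqpowP _ _ _ p0).
  exists (u * ((x ^+ 2 / 4 - x ^+ 3 / 2 + x ^+ 4 / 4) * h ^+ 2
    + (5 / 8 * x - 21 / 16 * x ^+ 2 + 7 / 8 * x ^+ 3 - 3 / 16 * x ^+ 4) * h
    + (3 / 8 - 59 / 48 * x + 37 / 32 * x ^+ 2 - 25 / 48 * x ^+ 3
       + 3 / 32 * x ^+ 4))
    - 175 / 384 + 91 / 576 * x - 3 / 128 * x ^+ 2).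
    pint_closed.
  by rewrite /h; field.
Qed.
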